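(* Writing $B_k^{nb}:=B_k^{neobc}$ and $C_k^{nb}:=C_k^{neobc}$: $$S_n=\frac1{36}\begin{cases}(4B^{nb}_{\frac{n+1}{2}}-C^{nb}_{\frac{n+1}{2}}-3)^2 & n\geq1\text{ odd},\\ (20B^{nb}_{\frac{n+2}{2}}-7C^{nb}_{\frac{n+2}{2}}-15)^2 & n\geq2\text{ even},\end{cases}$$ $$s_n=\frac16\begin{cases}4B^{nb}_{\frac{n+1}{2}}-C^{nb}_{\frac{n+1}{2}}-3 & n\geq1\text{ odd},\\ 20B^{nb}_{\frac{n+2}{2}}-7C^{nb}_{\frac{n+2}{2}}-15 & n\geq2\text{ even},\end{cases}$$ $$t_n=\frac1{12}\begin{cases}-8B^{nb}_{\frac{n+1}{2}}+4C^{nb}_{\frac{n+1}{2}} & n\geq1\text{ odd},\\ 60B^{nb}_{\frac{n+2}{2}}-4B^{nb}_{\frac{n}{2}}-21C^{nb}_{\frac{n+2}{2}}+C^{nb}_{\frac{n}{2}}-48 & n\geq2\text{ even}.\end{cases}$$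
   Context: Let $\alpha=1+\sqrt2$, $\beta=1-\sqrt2$. For $k\ge1$: $S_k=\frac{\alpha^{4k}+\beta^{4k}-2}{32}$ is the $k$-th square triangular number, $S_k=s_k^2=\frac{t_k(t_k+1)}{2}$ with $s_k=\frac{\alpha^{2k}-\beta^{2k}}{4\sqrt2}$ and $t_k=\frac{\alpha^{2k}+\beta^{2k}-2}{4}$. A positive integer $m$ is a neo balcobalancing number if there is a positive integer $r$ such that $(1+2+\cdots+(m-1))+(1+2+\cdots+m)=2[(m-1)+m+(m+1)+(m+2)+\cdots+(m+r)]$ (equivalently, $8m^2-12m+9$ is a perfect square). $B_k^{neobc}$ is the $k$-th neo balcobalancing number in increasing order ($k\ge1$) and $C_k^{neobc}=\sqrt{8(B_k^{neobc})^2-12B_k^{neobc}+9}$. *)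

(* Defs.v *)
From mathcomp Require Import all_boot all_order all_algebra.
From mathcomp Require Import zify.

Set Implicit Arguments.
Unset Strict Implicit.
Unset Printing Implicit Defensive.

Import Order.TTheory GRing.Theory Num.Theory.

Definition neobc_eq (m r : nat) : Prop :=
  \sum_(1 <= i < m) i + \sum_(1 <= i < m.+1) i
    = 2 * \sum_(m.-1 <= i < (m + r).+1) i.

Definition neobc (m : nat) : Prop :=
  0 < m /\ exists r : nat, 0 < r /\ neobc_eq m r.

(* The bound on r is harmless, see neobcP. *)
Definition neobcb (m : nat) : bool :=
  (0 < m) && [exists r : 'I_(m ^ 2).+1, (0 < r) &&
    (\sum_(1 <= i < m) i + \sum_(1 <= i < m.+1) i
      == 2 * \sum_(m.-1 <= i < (m + r).+1) i)].

Lemma neobc_sum_lo m : 0 < m ->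
  \sum_(1 <= i < m) i + \sum_(1 <= i < m.+1) i = m ^ 2.
Proof.
case: m => // m _; elim: m => [|m IHm]; first by rewrite big_geq // big_nat1.
rewrite big_nat_recr // [\sum_(1 <= i < m.+3) i]big_nat_recr //=; lia.
Qed.

Lemma neobc_sum_hi m r : 0 < m ->
  2 * \sum_(m.-1 <= i < (m + r).+1) i = (r + 2) * (2 * m + r - 1).
Proof.
case: m => // m _ /=; elim: r => [|r IHr].
  by rewrite addn0 big_nat_recr //= big_nat1; lia.
rewrite addnS big_nat_recr /=; last by lia.
rewrite mulnDr IHr; nia.
Qed.

Lemma neobc_eqE m r : 0 < m ->
  neobc_eq m r <-> m ^ 2 = (r + 2) * (2 * m + r - 1).
Proof. by move=> m0; rewrite /neobc_eq neobc_sum_lo // neobc_sum_hi. Qed.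

Lemma neobcP m : reflect (neobc m) (neobcb m).
Proof.
apply: (iffP andP) => [[m0 /existsP[r /andP[r0 /eqP e]]]|[m0 [r [r0 e]]]].
  by split=> //; exists (nat_of_ord r).
split=> //; have lt_r : r < (m ^ 2).+1 by move/(neobc_eqE _ m0): e; nia.
by apply/existsP; exists (Ordinal lt_r); rewrite r0; apply/eqP.
Qed.

Lemma neobc_unbounded n : exists m, neobcb m && (n < m).
Proof.
suff [m [r [nm r0 e]]] : exists m r,
    [/\ n < m, 0 < r & m ^ 2 = (r + 2) * (2 * m + r - 1)].
  exists m; rewrite nm andbT; apply/neobcP; split; first by lia.
  by exists r; split=> //; apply/neobc_eqE => //; lia.
elim: n => [|n [m [r [nm r0 e]]]]; first by exists 6, 1.
exists (29 * m + 12 * r - 6), (12 * m + 5 * r - 4); split; [lia|lia|].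
case: m r nm r0 e => [|m] [|r] // nm _ e.
have -> : 29 * m.+1 + 12 * r.+1 - 6 = 29 * m + 12 * r + 35 by lia.
have -> : 12 * m.+1 + 5 * r.+1 - 4 = 12 * m + 5 * r + 13 by lia.
have -> : 2 * (29 * m + 12 * r + 35) + (12 * m + 5 * r + 13) - 1
          = 70 * m + 29 * r + 82 by lia.
have {}e : m.+1 ^ 2 = (r + 3) * (2 * m + r + 2) by rewrite e; congr (_ * _); lia.
nia.
Qed.

(* neobc_nth k is the k-th neo balcobalancing number for k >= 1:
   neobc_nth 1 is the least one and neobc_nth k.+1 the least one exceeding
   neobc_nth k.  The value 0 at k = 0 only seeds the recursion. *)
Fixpoint neobc_nth (k : nat) : nat :=
  if k is k'.+1 then ex_minn (neobc_unbounded (neobc_nth k')) else 0.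

Local Open Scope ring_scope.

Definition Bnb (R : rcfType) (k : nat) : R := (neobc_nth k)%:R.

Definition Cnb (R : rcfType) (k : nat) : R :=
  Num.sqrt (8 * Bnb R k ^+ 2 - 12 * Bnb R k + 9).

Definition alpha (R : rcfType) : R := 1 + Num.sqrt 2.
Definition beta (R : rcfType) : R := 1 - Num.sqrt 2.

(* sqtri, sqtri_side and sqtri_index are S_k, s_k and t_k, given by their
   Binet formulas; S_k = s_k ^ 2 = t_k (t_k + 1) / 2. *)
Definition sqtri (R : rcfType) (k : nat) : R :=
  (alpha R ^+ (4 * k) + beta R ^+ (4 * k) - 2) / 32.

Definition sqtri_side (R : rcfType) (k : nat) : R :=
  (alpha R ^+ (2 * k) - beta R ^+ (2 * k)) / (4 * Num.sqrt 2).

Definition sqtri_index (R : rcfType) (k : nat) : R :=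
  (alpha R ^+ (2 * k) + beta R ^+ (2 * k) - 2) / 4.

(* Main.v *)
(** The condition reads [m ^ 2 = (r + 2) (2 m + r - 1)], so that
    [c = 2 m + 2 r + 1] satisfies [c ^ 2 = 8 m ^ 2 - 12 m + 9].  Multiplication
    by [alpha ^ 4] acts on the solutions [(m, r)] as the affine map
    [neobc_step].  Its inverse takes every solution with [m > 6] to a smaller
    solution, so all solutions arise from [(6, 1)] by iteration.  The numbers
    [s_n] and [t_n] satisfy the linear recurrence coming from multiplication by
    [alpha ^ 2], and for odd [n] the stated formulas propagate along the two
    recurrences; the even case is one backward step from [n + 1]. *)
Require Import Defs.
From mathcomp Require Import all_boot all_order all_algebra.
From mathcomp Require Import zify ring lra.

Set Implicit Arguments.
Unset Strict Implicit.
Unset Printing Implicit Defensive.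

Import Order.TTheory GRing.Theory Num.Theory.

Definition neobc_sol (m r : nat) : Prop :=
  [/\ 0 < m, 0 < r & m ^ 2 = (r + 2) * (2 * m + r - 1)].

(** With c = 2m + 2r + 1 the equation reads (4m - 3)^2 - 2c^2 = -9. The map multiplies (4m - 3) + c
    sqrt 2 by alpha^4 = 17 + 12 sqrt 2, written back in (m, r). The truncated subtractions are exact
    for m, r > 0. *)
Definition neobc_step (p : nat * nat) : nat * nat :=
  (29 * p.1 + 12 * p.2 - 6, 12 * p.1 + 5 * p.2 - 4).

Definition neobc_pair (k : nat) : nat * nat := iter k neobc_step (6, 1).

Lemma neobc_solP m : neobc m <-> exists r, neobc_sol m r.
Proof.
split=> [[m0 [r [r0 e]]]|[r [m0 r0 e]]].
  by exists r; split=> //; apply/neobc_eqE.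
by split=> //; exists r; split=> //; apply/neobc_eqE.
Qed.

Lemma neobc_step_sol m r : neobc_sol m r ->
  neobc_sol (neobc_step (m, r)).1 (neobc_step (m, r)).2.
Proof.
case=> m0 r0 e; rewrite /neobc_step /=; split; [lia | lia |].
(* Shifting both variables by one removes every truncated subtraction before [nia]. *)
case: m r m0 r0 e => [|m] [|r] // _ _ e.
have -> : 29 * m.+1 + 12 * r.+1 - 6 = 29 * m + 12 * r + 35 by lia.
have -> : 12 * m.+1 + 5 * r.+1 - 4 = 12 * m + 5 * r + 13 by lia.
have -> : 2 * (29 * m + 12 * r + 35) + (12 * m + 5 * r + 13) - 1
          = 70 * m + 29 * r + 82 by lia.
have {}e : m.+1 ^ 2 = (r + 3) * (2 * m + r + 2).
  by rewrite e; congr (_ * _); lia.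
nia.
Qed.

Lemma neobc_pair_sol k : neobc_sol (neobc_pair k).1 (neobc_pair k).2.
Proof.
elim: k => [//|k]; rewrite /neobc_pair iterS.
by case: (iter k neobc_step _) => m r; apply: neobc_step_sol.
Qed.

Lemma neobc_sol_descent m r : neobc_sol m r -> 6 < m ->
  exists m' r', [/\ neobc_sol m' r', m' < m & neobc_step (m', r') = (m, r)].
Proof.
case=> m0 r0 e m6.
(* The inverse of [neobc_step] sends (m, r) to (5m - 12r - 18, 29r + 44 - 12m). If the first entry
   were not positive, bounding both factors in [e] from below would give (m - 6)(m + 30) <= 0. *)
have ub : 12 * r + 18 < 5 * m.
  rewrite ltnNge; apply/negP => h.
  have h1 : 5 * m + 6 <= 12 * (r + 2) by lia.
  have h2 : 29 * m - 30 <= 12 * (2 * m + r - 1) by lia.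
  have := leq_mul h1 h2.
  have -> : 12 * (r + 2) * (12 * (2 * m + r - 1)) = 144 * m ^ 2.
    by rewrite e; ring.
  nia.
have [q eq] : exists q, 5 * m = 12 * r + 18 + q.
  by exists (5 * m - (12 * r + 18)); lia.
have cpos : 14 * m <= 34 * r + 52.
  rewrite leqNgt; apply/negP => h.
  have h1 : 17 * (r + 2) <= 7 * m + 7 by lia.
  have h2 : 17 * (2 * m + r - 1) <= 41 * m - 44 by lia.
  have := leq_mul h1 h2.
  have -> : 17 * (r + 2) * (17 * (2 * m + r - 1)) = 289 * m ^ 2.
    by rewrite e; ring.
  nia.
have {}e : m * m + r + 2 = (r + 2) * (2 * m + r) by nia.
have lb : 12 * m < 29 * r + 44.
  rewrite ltnNge; apply/negP => h.
  have [p ep] : exists p, 12 * m = 29 * r + 44 + p.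
    by exists (12 * m - (29 * r + 44)); lia.
  (* [(q, - p)] solves the equation too, and [cpos], that is [p <= q], puts it
     on the branch [c > 0] of the conic. *)
  have [d ed] : exists d, q = p + d by exists (q - p); lia.
  have em : m + 6 = 17 * p + 29 * d by lia.
  have er : r + 4 = 7 * p + 12 * d by lia.
  have e' : 2 * p * p + 4 * p * d + d * d + 2 = 3 * p + 4 * d by nia.
  (* For p = 0 the equation is d^2 + 2 = 4d, for p = 1 it is d^2 + 1 = 0, and for p >= 2 the left
     side exceeds the right. *)
  case: p e' {ep ed em er} => [|[|p]] e'; [|nia|nia].
  by case: d e' => [|[|[|[|d]]]] e'; nia.
exists (5 * m - 12 * r - 18), (29 * r + 44 - 12 * m).
split; [split | |]; rewrite /neobc_step /=; try lia; try nia.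
by congr (_, _); lia.
Qed.

Lemma neobc_pairP m r : neobc_sol m r -> exists k, neobc_pair k = (m, r).
Proof.
elim/ltn_ind: m r => m IH r hs.
have [m6|m6] := ltnP 6 m; last first.
  (* As r >= 1, the equation gives m^2 >= 6m, with equality only for r = 1; so m <= 6 forces (6,
     1). *)
  case: hs => m0 r0 e; exists 0; congr (_, _); nia.
have [m' [r' [hs' lt e]]] := neobc_sol_descent hs m6.
have [k ek] := IH _ lt _ hs'; exists k.+1.
by rewrite /neobc_pair iterS -/(neobc_pair k) ek.
Qed.

Lemma neobc_pair_lt j k : j < k -> (neobc_pair j).1 < (neobc_pair k).1.
Proof.
elim: k => // k IH; rewrite ltnS => jk.
have lt : (neobc_pair k).1 < (neobc_pair k.+1).1.
  have [m0 r0 _] := neobc_pair_sol k.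
  rewrite [neobc_pair k.+1]iterS /neobc_step /= -/(neobc_pair k); lia.
by move: jk; rewrite leq_eqVlt => /orP[/eqP->//|/IH/ltn_trans]; apply.
Qed.

(** The pairs exhaust the solutions and their first entries strictly increase, so the least solution
    beyond one pair is the next pair. The indices differ by one because [neobc_nth 0] is only a
    seed. *)
Lemma neobc_nthS k : neobc_nth k.+1 = (neobc_pair k).1.
Proof.
have nthS i : neobc_nth i.+1 = ex_minn (neobc_unbounded (neobc_nth i)) by [].
elim: k => [|k IH]; rewrite nthS.
  case: ex_minnP => m /andP[/neobcP/neobc_solP[r hs] m0] min.
  have [j ej] := neobc_pairP hs.
  have := min 6; rewrite (_ : neobcb 6) => [|]; last first.
    by apply/neobcP/neobc_solP; exists 1.
  move=> /(_ isT) le6; case: j ej => [[<-] //|j ej].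
  by have := neobc_pair_lt (ltn0Sn j); rewrite ej /=; lia.
rewrite IH; case: ex_minnP => m /andP[/neobcP/neobc_solP[r hs] lt] min.
have [j ej] := neobc_pairP hs.
apply/eqP; rewrite eqn_leq; apply/andP; split.
  apply: min; rewrite neobc_pair_lt // andbT; apply/neobcP/neobc_solP.
  by exists (neobc_pair k.+1).2; apply: neobc_pair_sol.
have em : m = (neobc_pair j).1 by rewrite ej.
rewrite {m r hs min ej}em in lt *.
have [jk|kj] := leqP j k.
  by move: jk lt; rewrite leq_eqVlt => /orP[/eqP->|/neobc_pair_lt]; lia.
by move: kj; rewrite leq_eqVlt => /orP[/eqP->|/neobc_pair_lt/ltnW].
Qed.

Local Open Scope ring_scope.

Section RealClosedField.
Variable R : rcfType.

Lemma BnbS k : Bnb R k.+1 = (neobc_pair k).1%:R.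
Proof. by rewrite /Bnb neobc_nthS. Qed.

Lemma CnbS k :
  Cnb R k.+1 = 2 * (neobc_pair k).1%:R + 2 * (neobc_pair k).2%:R + 1.
Proof.
rewrite /Cnb BnbS; have [m0 r0 e] := neobc_pair_sol k.
move: (neobc_pair k).1 (neobc_pair k).2 m0 r0 e => m r m0 r0 e.
have {}e : (m * m + r + 2 = (r + 2) * (2 * m + r))%N by nia.
have {}e : m%:R * m%:R + r%:R + 2 = (r%:R + 2) * (2 * m%:R + r%:R) :> R.
  by have := congr1 (fun x => x%:R : R) e; rewrite !(natrD, natrM).
have mr : 0 <= 2 * m%:R + 2 * r%:R + 1 :> R.
  by rewrite !addr_ge0 ?mulr_ge0 ?ler0n.
rewrite -[RHS](ger0_norm mr) -sqrtr_sqr; congr Num.sqrt; lra.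
Qed.

Lemma neobc_pair1S k : (neobc_pair k.+1).1%:R =
  29 * (neobc_pair k).1%:R + 12 * (neobc_pair k).2%:R - 6 :> R.
Proof.
have [m0 r0 _] := neobc_pair_sol k.
rewrite [neobc_pair k.+1]iterS /neobc_step /= -/(neobc_pair k).
rewrite natrB; last by lia.
by rewrite natrD !natrM.
Qed.

Lemma neobc_pair2S k : (neobc_pair k.+1).2%:R =
  12 * (neobc_pair k).1%:R + 5 * (neobc_pair k).2%:R - 4 :> R.
Proof.
have [m0 r0 _] := neobc_pair_sol k.
rewrite [neobc_pair k.+1]iterS /neobc_step /= -/(neobc_pair k).
rewrite natrB; last by lia.
by rewrite natrD !natrM.
Qed.

Lemma sqr_sqrt2 : Num.sqrt 2 ^+ 2 = 2 :> R.
Proof. by rewrite sqr_sqrtr ?ler0n. Qed.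

Lemma sqrt2_neq0 : Num.sqrt 2 != 0 :> R.
Proof. by rewrite sqrtr_eq0 -ltNge ltr0n. Qed.

Lemma sqtri_sideS n :
  sqtri_side R n.+1 = 3 * sqtri_side R n + 2 * sqtri_index R n + 1.
Proof.
rewrite /sqtri_side /sqtri_index /alpha /beta mulnS !(exprD _ 2 (2 * n)).
move: sqrt2_neq0 sqr_sqrt2; set w := Num.sqrt 2 => w0 w2.
move: ((1 + w) ^+ (2 * n)) ((1 - w) ^+ (2 * n)) => a b.
have wi : w^-1 = w / 2 by rewrite -w2; field.
have wp : (1 + w) ^+ 2 = 3 + 2 * w by rewrite sqrrD w2; ring.
have wm : (1 - w) ^+ 2 = 3 - 2 * w by rewrite sqrrB w2; ring.
(* [lra] is linear, so the relation w^2 = 2 has to be supplied already multiplied by a and by b. *)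
have wa : w ^+ 2 * a = 2 * a by rewrite w2.
have wb : w ^+ 2 * b = 2 * b by rewrite w2.
rewrite wp wm invfM wi; lra.
Qed.

Lemma sqtri_indexS n :
  sqtri_index R n.+1 = 4 * sqtri_side R n + 3 * sqtri_index R n + 1.
Proof.
rewrite /sqtri_side /sqtri_index /alpha /beta mulnS !(exprD _ 2 (2 * n)).
move: sqrt2_neq0 sqr_sqrt2; set w := Num.sqrt 2 => w0 w2.
move: ((1 + w) ^+ (2 * n)) ((1 - w) ^+ (2 * n)) => a b.
have wi : w^-1 = w / 2 by rewrite -w2; field.
have wp : (1 + w) ^+ 2 = 3 + 2 * w by rewrite sqrrD w2; ring.
have wm : (1 - w) ^+ 2 = 3 - 2 * w by rewrite sqrrB w2; ring.
rewrite wp wm invfM wi; lra.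
Qed.

Lemma sqtri_side0 : sqtri_side R 0 = 0.
Proof. by rewrite /sqtri_side !expr0 subrr mul0r. Qed.

Lemma sqtri_index0 : sqtri_index R 0 = 0.
Proof. by rewrite /sqtri_index !expr0; field. Qed.

Lemma sqtriE n : sqtri R n = sqtri_side R n ^+ 2.
Proof.
rewrite /sqtri /sqtri_side (_ : 4 * n = 2 * n + 2 * n)%N; last by lia.
(* Since alpha beta = -1, even powers multiply to 1; the cross term of the square is therefore the
   -2 in S_n. *)
have ab : alpha R ^+ (2 * n) * beta R ^+ (2 * n) = 1.
  rewrite -exprMn exprM /alpha /beta.
  rewrite (_ : ((1 + Num.sqrt 2) * (1 - Num.sqrt 2)) ^+ 2 = 1) ?expr1n //.
  by rewrite mulrC -subr_sqr expr1n sqr_sqrt2; ring.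
move: ab; rewrite !(exprD _ (2 * n) (2 * n)).
move: (alpha R ^+ _) (beta R ^+ _) => a b ab.
rewrite expr_div_n exprMn sqr_sqrt2; lra.
Qed.

(** This is the odd case in terms of (m, r): with C = 2m + 2r + 1, 4B - C - 3 = 2(m - r - 2) and -8B
    + 4C = 4(2r + 1). One step on pairs matches two steps of n, and s and t are coupled, so both go
    in one induction. *)
Lemma sqtri_odd_pair k :
  3 * sqtri_side R k.*2.+1 = (neobc_pair k).1%:R - (neobc_pair k).2%:R - 2 /\
  3 * sqtri_index R k.*2.+1 = 2 * (neobc_pair k).2%:R + 1.
Proof.
elim: k => [|k [IHs IHt]].
  by rewrite sqtri_sideS sqtri_indexS sqtri_side0 sqtri_index0 /=; split; ring.
rewrite doubleS neobc_pair1S neobc_pair2S.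
rewrite (sqtri_sideS k.*2.+2) (sqtri_indexS k.*2.+2).
rewrite (sqtri_sideS k.*2.+1) (sqtri_indexS k.*2.+1).
split; lra.
Qed.

End RealClosedField.

Theorem theorem6p3 (R : rcfType) (n : nat) (hn : (1 <= n)%N) :
  [/\ sqtri R n = 1 / 36 *
        (if odd n then
           (4 * Bnb R ((n + 1) %/ 2) - Cnb R ((n + 1) %/ 2) - 3) ^+ 2
         else
           (20 * Bnb R ((n + 2) %/ 2) - 7 * Cnb R ((n + 2) %/ 2) - 15) ^+ 2),
      sqtri_side R n = 1 / 6 *
        (if odd n then
           4 * Bnb R ((n + 1) %/ 2) - Cnb R ((n + 1) %/ 2) - 3
         else
           20 * Bnb R ((n + 2) %/ 2) - 7 * Cnb R ((n + 2) %/ 2) - 15)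
    & sqtri_index R n = 1 / 12 *
        (if odd n then
           - 8 * Bnb R ((n + 1) %/ 2) + 4 * Cnb R ((n + 1) %/ 2)
         else
           60 * Bnb R ((n + 2) %/ 2) - 4 * Bnb R (n %/ 2)
             - 21 * Cnb R ((n + 2) %/ 2) + Cnb R (n %/ 2) - 48)].
Proof.
rewrite sqtriE.
suff [-> ->] : sqtri_side R n = 1 / 6 *
        (if odd n then
           4 * Bnb R ((n + 1) %/ 2) - Cnb R ((n + 1) %/ 2) - 3
         else
           20 * Bnb R ((n + 2) %/ 2) - 7 * Cnb R ((n + 2) %/ 2) - 15)
    /\ sqtri_index R n = 1 / 12 *
        (if odd n then
           - 8 * Bnb R ((n + 1) %/ 2) + 4 * Cnb R ((n + 1) %/ 2)
         else
           60 * Bnb R ((n + 2) %/ 2) - 4 * Bnb R (n %/ 2)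
             - 21 * Cnb R ((n + 2) %/ 2) + Cnb R (n %/ 2) - 48).
  by split=> //; case: (odd n); field.
case: (boolP (odd n)) => on.
  have -> : ((n + 1) %/ 2 = n./2.+1)%N by lia.
  have [] := sqtri_odd_pair R n./2.
  have -> : n./2.*2.+1 = n by lia.
  by rewrite BnbS CnbS => hs ht; split; lra.
have [j ej] : exists j, n = j.+1.*2 by exists n./2.-1; lia.
have -> : ((n + 2) %/ 2 = j.+2)%N by lia.
have -> : (n %/ 2 = j.+1)%N by lia.
(* The odd case at n + 1 and the recurrences form a linear system for s_n and t_n. B and C at n/2
   belong to pair j, so pair j + 1 is expanded in terms of it. *)
have [] := sqtri_odd_pair R j.+1.
rewrite -ej sqtri_sideS sqtri_indexS !BnbS !CnbS neobc_pair1S neobc_pair2S.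
by move=> hs ht; split; lra.
Qed.
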